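(* The statement $\mathsf{HT}^{\leq 2}_2$ is not provable in $\mathsf{RCA}_0$.
   Context: $\mathsf{RCA}_0$ is the standard base system of reverse mathematics: the subsystem of second-order arithmetic consisting of the basic axioms of arithmetic, $\Sigma^0_1$-induction, and $\Delta^0_1$-comprehension. $\mathbb{N}$ denotes the set of positive integers. For a finite nonempty $F\subseteq\mathbb{N}$, $\sum F$ denotes the sum of the elements of $F$. For $X\subseteq\mathbb{N}$ and $n\geq 1$, $\mathrm{FS}^{\leq n}(X)=\{\sum F \mid F\subseteq X \text{ and } 1\leq |F|\leq n\}$. A set $Z\subseteq\mathbb{N}$ is monochromatic for a coloring $c$ if $c(x)=c(y)$ for all $x,y\in Z$. $\mathsf{HT}^{\leq n}_k$ is the statement (of second-order arithmetic) that for every coloring $c:\mathbb{N}\to\{0,\dots,k-1\}$ there is an infinite set $X\subseteq\mathbb{N}$ such that $\mathrm{FS}^{\leq n}(X)$ is monochromatic for $c$. *)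

(* Defs.v *)
From mathcomp Require Import all_boot.
From Stdlib Require List.

Set Implicit Arguments.
Unset Strict Implicit.
Unset Printing Implicit Defensive.

(** * Second-order arithmetic

    Two-sorted de Bruijn syntax.  Number variables and set variables are
    indexed separately: a number quantifier binds number variable 0 and leaves
    the set indices alone, and conversely.  The only set terms are variables,
    and set equality is not primitive. *)

Inductive term : Type :=
| Var of nat
| Zero
| One
| Add of term & term
| Mul of term & term.

Inductive form : Type :=
| Eq of term & term
| Lt of term & term
| In of term & nat
| Bot
| Imp of form & form
| And of form & form
| Or of form & form
| AllN of form
| ExN of form
| AllS of form
| ExS of form.

Declare Scope term_scope.
Delimit Scope term_scope with T.
Bind Scope term_scope with term.
Declare Scope form_scope.
Delimit Scope form_scope with F.
Bind Scope form_scope with form.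

Notation "0" := Zero : term_scope.
Notation "1" := One : term_scope.
Notation "s + t" := (Add s t) : term_scope.
Notation "s * t" := (Mul s t) : term_scope.
Notation "# i" := (Var i) (at level 2, i at level 1, format "# i") : term_scope.

Notation "s ≐ t" := (Eq s t) (at level 70, no associativity) : form_scope.
Notation "s ≺ t" := (Lt s t) (at level 70, no associativity) : form_scope.
Notation "t ∈ X" := (In t X) (at level 70, no associativity) : form_scope.
Notation "⊥" := Bot : form_scope.
Notation "p ∧ q" := (And p q) (at level 80, right associativity) : form_scope.
Notation "p ∨ q" := (Or p q) (at level 85, right associativity) : form_scope.
Notation "p ⇒ q" := (Imp p q) (at level 90, right associativity) : form_scope.

Definition Neg (p : form) : form := (p ⇒ ⊥)%F.
Definition Iff (p q : form) : form := ((p ⇒ q) ∧ (q ⇒ p))%F.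

Notation "¬ p" := (Neg p) (at level 75, right associativity) : form_scope.
Notation "p ⇔ q" := (Iff p q) (at level 95, no associativity) : form_scope.

(** ** Simultaneous substitution: [s] sends number variables to terms, [r]
    sends set variables to set variables. *)

Fixpoint tsubst (s : nat -> term) (t : term) : term :=
  match t with
  | Var i => s i
  | Zero => Zero
  | One => One
  | Add t1 t2 => Add (tsubst s t1) (tsubst s t2)
  | Mul t1 t2 => Mul (tsubst s t1) (tsubst s t2)
  end.

Definition scons (A : Type) (a : A) (f : nat -> A) (i : nat) : A :=
  if i is j.+1 then f j else a.

Definition tshift (k : nat) : term -> term := tsubst (fun i => Var (k + i)).

Definition upN (s : nat -> term) : nat -> term :=
  scons (Var 0) (fun i => tshift 1 (s i)).

Definition upS (r : nat -> nat) : nat -> nat := scons 0 (fun i => (r i).+1).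

Fixpoint subst (s : nat -> term) (r : nat -> nat) (p : form) : form :=
  match p with
  | Eq t u => Eq (tsubst s t) (tsubst s u)
  | Lt t u => Lt (tsubst s t) (tsubst s u)
  | In t X => In (tsubst s t) (r X)
  | Bot => Bot
  | Imp p q => Imp (subst s r p) (subst s r q)
  | And p q => And (subst s r p) (subst s r q)
  | Or p q => Or (subst s r p) (subst s r q)
  | AllN p => AllN (subst (upN s) r p)
  | ExN p => ExN (subst (upN s) r p)
  | AllS p => AllS (subst s (upS r) p)
  | ExS p => ExS (subst s (upS r) p)
  end.

Definition shiftN : form -> form := subst (fun i => Var i.+1) id.
Definition shiftS : form -> form := subst Var succn.

Definition instN (p : form) (t : term) : form := subst (scons t Var) id p.
Definition instS (p : form) (X : nat) : form := subst Var (scons X id) p.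

(** ** Classical natural deduction from a theory [T]

    [AllN_i] and its siblings shift the context but not [T], so an axiom with
    free variables has the force of its universal closure. *)

Inductive proves (T : form -> Prop) : seq form -> form -> Prop :=
| Ax G p : T p -> proves T G p
| Hyp G p : List.In p G -> proves T G p
| Imp_i G p q : proves T (p :: G) q -> proves T G (p ⇒ q)
| Imp_e G p q : proves T G (p ⇒ q) -> proves T G p -> proves T G q
| And_i G p q : proves T G p -> proves T G q -> proves T G (p ∧ q)
| And_el G p q : proves T G (p ∧ q) -> proves T G p
| And_er G p q : proves T G (p ∧ q) -> proves T G q
| Or_il G p q : proves T G p -> proves T G (p ∨ q)
| Or_ir G p q : proves T G q -> proves T G (p ∨ q)
| Or_e G p q r : proves T G (p ∨ q) ->
    proves T (p :: G) r -> proves T (q :: G) r -> proves T G r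
| Raa G p : proves T (Neg p :: G) Bot -> proves T G p
| AllN_i G p : proves T (map shiftN G) p -> proves T G (AllN p)
| AllN_e G p t : proves T G (AllN p) -> proves T G (instN p t)
| ExN_i G p t : proves T G (instN p t) -> proves T G (ExN p)
| ExN_e G p q : proves T G (ExN p) ->
    proves T (p :: map shiftN G) (shiftN q) -> proves T G q
| AllS_i G p : proves T (map shiftS G) p -> proves T G (AllS p)
| AllS_e G p X : proves T G (AllS p) -> proves T G (instS p X)
| ExS_i G p X : proves T G (instS p X) -> proves T G (ExS p)
| ExS_e G p q : proves T G (ExS p) ->
    proves T (p :: map shiftS G) (shiftS q) -> proves T G q
| Eq_i G t : proves T G (t ≐ t)
| Eq_e G p t u : proves T G (t ≐ u) -> proves T G (instN p t) ->
    proves T G (instN p u).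

Definition provable (T : form -> Prop) (p : form) : Prop := proves T [::] p.

(** * The system RCA_0 *)

(** [tshift 1 t] in the bounded quantifiers: the bound variable does not occur
    in the bound. *)
Inductive Delta00 : form -> Prop :=
| D_Eq t u : Delta00 (t ≐ u)
| D_Lt t u : Delta00 (t ≺ u)
| D_In t X : Delta00 (t ∈ X)
| D_Bot : Delta00 ⊥
| D_Imp p q : Delta00 p -> Delta00 q -> Delta00 (p ⇒ q)
| D_And p q : Delta00 p -> Delta00 q -> Delta00 (p ∧ q)
| D_Or p q : Delta00 p -> Delta00 q -> Delta00 (p ∨ q)
| D_AllN t p : Delta00 p -> Delta00 (AllN (#0 ≺ tshift 1 t ⇒ p))
| D_ExN t p : Delta00 p -> Delta00 (ExN (#0 ≺ tshift 1 t ∧ p)).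

Inductive Sigma01 : form -> Prop :=
| Sigma01_ex p : Delta00 p -> Sigma01 (ExN p).

Inductive Pi01 : form -> Prop :=
| Pi01_all p : Delta00 p -> Pi01 (AllN p).

Definition basic_axioms : seq form :=
  [:: ¬ (#0 + 1 ≐ 0);
      #0 + 1 ≐ #1 + 1 ⇒ #0 ≐ #1;
      #0 + 0 ≐ #0;
      #0 + (#1 + 1) ≐ (#0 + #1) + 1;
      #0 * 0 ≐ 0;
      #0 * (#1 + 1) ≐ #0 * #1 + #0;
      ¬ (#0 ≺ 0);
      #0 ≺ #1 + 1 ⇔ (#0 ≺ #1 ∨ #0 ≐ #1)]%F.

(** [p] is read as a property of number variable 0; the substitution in the
    step is [p] at [#0 + 1], still under the quantifier. *)
Definition induction_for (p : form) : form :=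
  (instN p 0 ∧ AllN (p ⇒ subst (scons (#0 + 1)%T (fun i => Var i.+1)) id p)
   ⇒ AllN p)%F.

(** [shiftS p] in the conclusion: the set being defined is not free in [p]. *)
Definition comprehension_for (p q : form) : form :=
  (AllN (p ⇔ q) ⇒ ExS (AllN (#0 ∈ 0%N ⇔ shiftS p)))%F.

Inductive RCA0 : form -> Prop :=
| RCA0_basic p : List.In p basic_axioms -> RCA0 p
| RCA0_induction p : Sigma01 p -> RCA0 (induction_for p)
| RCA0_comprehension p q :
    Sigma01 p -> Pi01 q -> RCA0 (comprehension_for p q).

(** * Hindman's theorem for sums of at most [n] elements, in the language of
    second-order arithmetic

    The number sort contains 0, whereas colorings and solutions live on the
    positive integers, hence the explicit positivity conditions.  [n] and [k]
    are fixed natural numbers of the metatheory. *)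

Fixpoint numeral (k : nat) : term :=
  if k is j.+1 then (numeral j + 1)%T else 0%T.

Definition big_and (ps : seq form) : form := foldr And (Neg Bot) ps.
Definition big_or (ps : seq form) : form := foldr Or Bot ps.
Definition tsum (ts : seq term) : term := foldr Add 0%T ts.

(** The pairing function [(x, y) |-> (x + y)^2 + x]. *)
Definition pair (x y : term) : term := ((x + y) * (x + y) + x)%T.

(** [C] is (the graph of) a function from the positive integers to
    [{0, ..., k-1}]. *)
Definition is_coloring (k C : nat) : form :=
  (AllN (#0 ∈ C ⇒
      ExN (ExN (0 ≺ #1 ∧ #0 ≺ numeral k ∧ #2 ≐ pair #1 #0)))
   ∧ AllN (0 ≺ #0 ⇒
      ExN ((#0 ≺ numeral k ∧ pair #1 #0 ∈ C)
           ∧ AllN (#0 ≺ numeral k ∧ pair #2 #0 ∈ C ⇒ #0 ≐ #1))))%F.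

Definition same_color (C : nat) (x y : term) : form :=
  ExN (pair (tshift 1 x) #0 ∈ C ∧ pair (tshift 1 y) #0 ∈ C)%F.

Definition monochromatic (C : nat) (Z : term -> form) : form :=
  AllN (AllN (Z (#1)%T ∧ Z (#0)%T ⇒ same_color C #1 #0))%F.

Definition positive_set (X : nat) : form := AllN (#0 ∈ X ⇒ 0 ≺ #0)%F.

Definition infinite (X : nat) : form := AllN (ExN (#1 ≺ #0 ∧ #0 ∈ X))%F.

(** [t] is the sum of the elements of some [F] included in [X] with [#|F| = j];
    [F] is given by its [j] pairwise distinct elements [#0, ..., #(j-1)]. *)
Definition sum_of_exactly (j X : nat) (t : term) : form :=
  iter j ExN
    (big_and [seq Var i ∈ X | i <- iota 0 j]
     ∧ big_and [seq ¬ (Var i ≐ Var i') | i' <- iota 0 j, i <- iota 0 i']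
     ∧ tshift j t ≐ tsum [seq Var i | i <- iota 0 j])%F.

Definition FSle (n X : nat) (t : term) : form :=
  big_or [seq sum_of_exactly j X t | j <- iota 1 n].

(** Inside [ExS], set variable 0 is the solution and 1 the coloring. *)
Definition HT (n k : nat) : form :=
  AllS (is_coloring k 0 ⇒
    ExS (positive_set 0 ∧ infinite 0 ∧ monochromatic 1 (FSle n 0)))%F.

(* Main.v *)
(** The sets that are Delta^0_1 in a coloring [c] form an omega-model of RCA_0
    for every [c], so by soundness it suffices to find a [c] such that no
    infinite [X] that is Sigma^0_1 in [c] satisfies [c (x + y) = c x] for all
    distinct [x], [y] in [X].  Such a [c] is built by forcing.  A condition fixes
    finitely many colors and locks finitely many ternary valuations [k]: late
    numbers [n = 3^k m] have a color determined by [k] and by [m mod 3], with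
    opposite colors for the residues 1 and 2.  Two late elements of [X] of the
    same locked valuation and residue have a sum of the other color.  So [X] has
    elements of unlocked valuation; forcing one such [x] into [X] uses only a
    finite part of [c], after which its valuation is locked to the color opposite
    to [c x], and then [x + y] has that color for late [y] of larger
    valuation. *)

Require Import Defs.
From mathcomp Require Import all_boot zify.
From Stdlib Require Import Classical ClassicalEpsilon FunctionalExtensionality.
From Stdlib Require List.

Set Implicit Arguments.
Unset Strict Implicit.
Unset Printing Implicit Defensive.

(** * Truth in omega-models and soundness of natural deduction *)

Fixpoint teval (rho : nat -> nat) (t : term) : nat :=
  match t with
  | Var i => rho i
  | Zero => 0
  | One => 1
  | Add t u => teval rho t + teval rho u
  | Mul t u => teval rho t * teval rho u
  end.

Lemma teval_subst rho s t :
  teval rho (tsubst s t) = teval (fun i => teval rho (s i)) t.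
Proof. by elim: t => //= t -> u ->. Qed.

Lemma teval_shift1 x rho t : teval (scons x rho) (tshift 1 t) = teval rho t.
Proof. by rewrite teval_subst. Qed.

Lemma teval_numeral rho k : teval rho (numeral k) = k.
Proof. by elim: k => //= k ->; rewrite addn1. Qed.

Lemma scons_comp (A B : Type) (f : A -> B) a g :
  (fun i => f (scons a g i)) = scons (f a) (fun i => f (g i)).
Proof. by apply: functional_extensionality => -[]. Qed.

Lemma teval_upN x rho s :
  (fun i => teval (scons x rho) (upN s i)) =
  scons x (fun i => teval rho (s i)).
Proof.
by apply: functional_extensionality => -[|i] //=; rewrite teval_shift1.
Qed.

(** Truth in the omega-model whose second-order part is [S]. *)
Fixpoint sat (S : (nat -> Prop) -> Prop) (p : form)
    (rho : nat -> nat) (sigma : nat -> nat -> Prop) : Prop :=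
  match p with
  | Eq t u => teval rho t = teval rho u
  | Lt t u => teval rho t < teval rho u
  | In t X => sigma X (teval rho t)
  | Bot => False
  | Imp p q => sat S p rho sigma -> sat S q rho sigma
  | And p q => sat S p rho sigma /\ sat S q rho sigma
  | Or p q => sat S p rho sigma \/ sat S q rho sigma
  | AllN p => forall x, sat S p (scons x rho) sigma
  | ExN p => exists x, sat S p (scons x rho) sigma
  | AllS p => forall X, S X -> sat S p rho (scons X sigma)
  | ExS p => exists2 X, S X & sat S p rho (scons X sigma)
  end.

Section Soundness.

Variable S : (nat -> Prop) -> Prop.

Lemma sat_subst p : forall s r rho sigma,
  sat S (subst s r p) rho sigma <->
  sat S p (fun i => teval rho (s i)) (fun i => sigma (r i)).
Proof.
elim: p => [t u|t u|t X| |p IHp q IHq|p IHp q IHq|p IHp q IHq|p IH|p IH|p IH|p IH]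
  s r rho sigma /=; rewrite ?teval_subst //; try by rewrite IHp IHq.
- by split=> h x; move: (h x); rewrite IH teval_upN.
- by split=> -[x h]; exists x; move: h; rewrite IH teval_upN.
- by split=> h X SX; move: (h X SX); rewrite IH /upS (scons_comp (scons X sigma)).
- by split=> -[X SX h]; exists X => //; move: h; rewrite IH /upS (scons_comp (scons X sigma)).
Qed.

Lemma sat_shiftN p x rho sigma :
  sat S (shiftN p) (scons x rho) sigma <-> sat S p rho sigma.
Proof. exact: sat_subst. Qed.

Lemma sat_shiftS p X rho sigma :
  sat S (shiftS p) rho (scons X sigma) <-> sat S p rho sigma.
Proof. exact: sat_subst. Qed.

Lemma sat_instN p t rho sigma :
  sat S (instN p t) rho sigma <-> sat S p (scons (teval rho t) rho) sigma.
Proof. by rewrite sat_subst (scons_comp (teval rho)). Qed.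

Lemma sat_instS p X rho sigma :
  sat S (instS p X) rho sigma <-> sat S p rho (scons (sigma X) sigma).
Proof. by rewrite sat_subst (scons_comp sigma). Qed.

(** Axioms must hold in every environment, because the quantifier introductions shift the context
    but not [T]. As set terms are variables, [forall i, S (sigma i)] covers every instance of
    [AllS_e]. *)
Lemma soundness (T : form -> Prop) :
  (forall p, T p -> forall rho sigma, (forall i, S (sigma i)) -> sat S p rho sigma) ->
  forall G p, proves T G p -> forall rho sigma, (forall i, S (sigma i)) ->
  (forall h, List.In h G -> sat S h rho sigma) -> sat S p rho sigma.
Proof.
move=> modelT G p; elim=> {G p}.
- by move=> G p Tp rho sigma Ssig _; exact: modelT.
- by move=> G p Gp rho sigma _; exact.
- move=> G p q _ IH rho sigma Ssig hG /= hp.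
  by apply: IH => // h /= [<-|]; [|exact: hG].
- by move=> G p q _ IHpq _ IHp rho sigma Ssig hG; apply: (IHpq _ _ Ssig hG); exact: IHp.
- by move=> G p q _ IHp _ IHq rho sigma Ssig hG; split; [exact: IHp|exact: IHq].
- by move=> G p q _ IH rho sigma Ssig hG; case: (IH _ _ Ssig hG).
- by move=> G p q _ IH rho sigma Ssig hG; case: (IH _ _ Ssig hG).
- by move=> G p q _ IH rho sigma Ssig hG; left; exact: IH.
- by move=> G p q _ IH rho sigma Ssig hG; right; exact: IH.
- move=> G p q r _ IHpq _ IHp _ IHq rho sigma Ssig hG.
  case: (IHpq _ _ Ssig hG) => [hp|hq].
  + by apply: IHp => // h /= [<-|]; [|exact: hG].
  + by apply: IHq => // h /= [<-|]; [|exact: hG].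
- move=> G p _ IH rho sigma Ssig hG; apply: NNPP => np.
  by apply: (IH _ _ Ssig) => h /= [<-|]; [|exact: hG].
- move=> G p _ IH rho sigma Ssig hG x; apply: IH => // h.
  by move=> /List.in_map_iff[h0 [<- /hG]]; rewrite sat_shiftN.
- by move=> G p t _ IH rho sigma Ssig hG; rewrite sat_instN; exact: IH.
- move=> G p t _ IH rho sigma Ssig hG.
  by exists (teval rho t); rewrite -sat_instN; exact: IH.
- move=> G p q _ IHp _ IHq rho sigma Ssig hG.
  case: (IHp _ _ Ssig hG) => x hx; rewrite -(sat_shiftN _ x).
  apply: IHq => // h /= [<- //|].
  by move=> /List.in_map_iff[h0 [<- /hG]]; rewrite sat_shiftN.
- move=> G p _ IH rho sigma Ssig hG X SX; apply: IH; first by case.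
  by move=> h /List.in_map_iff[h0 [<- /hG]]; rewrite sat_shiftS.
- by move=> G p X _ IH rho sigma Ssig hG; rewrite sat_instS; exact: IH.
- move=> G p X _ IH rho sigma Ssig hG.
  by exists (sigma X) => //; rewrite -sat_instS; exact: IH.
- move=> G p q _ IHp _ IHq rho sigma Ssig hG.
  case: (IHp _ _ Ssig hG) => X SX hX; rewrite -(sat_shiftS _ X).
  apply: IHq; [by case|move=> h /= [<- //|]].
  by move=> /List.in_map_iff[h0 [<- /hG]]; rewrite sat_shiftS.
- by [].
- move=> G p t u _ IHtu _ IHp rho sigma Ssig hG.
  by rewrite sat_instN -(IHtu _ _ Ssig hG : teval _ _ = _) -sat_instN; exact: IHp.
Qed.

End Soundness.

(** * Codes for relations that are Sigma^0_1 in an oracle *)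

(** Formulas with unbounded existential and bounded universal quantifiers over
    an oracle that may occur both positively and negatively; up to equivalence,
    the Sigma^0_1 formulas.  [CApp] relieves us from substituting into codes. *)
Inductive code : Type :=
| CEq of term & term
| CLt of term & term
| COracle of bool & term
| CAnd of code & code
| COr of code & code
| CAll of term & code
| CEx of code
| CApp of term & code.

Fixpoint csat (c : nat -> bool) (e : code) (rho : nat -> nat) : Prop :=
  match e with
  | CEq t u => teval rho t = teval rho u
  | CLt t u => teval rho t < teval rho u
  | COracle b t => c (teval rho t) = b
  | CAnd d e => csat c d rho /\ csat c e rho
  | COr d e => csat c d rho \/ csat c e rho
  | CAll t e => forall x, x < teval rho t -> csat c e (scons x rho)
  | CEx e => exists x, csat c e (scons x rho)
  | CApp t e => csat c e (scons (teval rho t) rho)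
  end.

Definition agree (N : nat) (c c' : nat -> bool) : Prop :=
  forall n, n < N -> c' n = c n.

(** The use principle: a true coded fact consults finitely many oracle values, and a bounded
    universal quantifier takes the maximum of finitely many uses. *)
Lemma csat_use c e : forall rho, csat c e rho ->
  exists N, forall c', agree N c c' -> csat c' e rho.
Proof.
elim: e => [t u|t u|b t|d IHd e IHe|d IHd e IHe|t e IH|e IH|t e IH] rho /=.
- by exists 0.
- by exists 0.
- by move=> <-; exists (teval rho t).+1 => c'; apply.
- move=> [/IHd[N hN] /IHe[M hM]]; exists (maxn N M) => c' h.
  by split; [apply: hN|apply: hM] => n nN; apply: h; lia.
- move=> [/IHd[N hN]|/IHe[M hM]]; [exists N|exists M] => c' h;
    [left; exact: hN|right; exact: hM].
- elim: (teval rho t) => [|m IHm] h; first by exists 0.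
  case: IHm => [x xm|N hN]; first by apply: h; lia.
  case: (IH _ (h m (ltnSn m))) => M hM; exists (maxn N M) => c' h' x.
  rewrite ltnS leq_eqVlt => /orP[/eqP->|xm].
  + by apply: hM => n nM; apply: h'; lia.
  + by apply: hN => // n nN; apply: h'; lia.
- by move=> [x /IH[N hN]]; exists N => c' h; exists x; exact: hN.
- exact: IH.
Qed.

(** * Countability of the codes *)

Fixpoint term_to_tree (t : term) : GenTree.tree nat :=
  match t with
  | Var i => GenTree.Leaf i
  | Zero => GenTree.Node 0 [::]
  | One => GenTree.Node 1 [::]
  | Add t u => GenTree.Node 2 [:: term_to_tree t; term_to_tree u]
  | Mul t u => GenTree.Node 3 [:: term_to_tree t; term_to_tree u]
  end.

Fixpoint tree_to_term (g : GenTree.tree nat) : term :=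
  match g with
  | GenTree.Leaf i => Var i
  | GenTree.Node 1 [::] => One
  | GenTree.Node 2 [:: g; h] => Add (tree_to_term g) (tree_to_term h)
  | GenTree.Node 3 [:: g; h] => Mul (tree_to_term g) (tree_to_term h)
  | _ => Zero
  end.

Lemma term_to_treeK : cancel term_to_tree tree_to_term.
Proof. by elim=> //= t -> u ->. Qed.

Fixpoint code_to_tree (e : code) : GenTree.tree nat :=
  match e with
  | CEq t u => GenTree.Node 0 [:: term_to_tree t; term_to_tree u]
  | CLt t u => GenTree.Node 1 [:: term_to_tree t; term_to_tree u]
  | COracle b t => GenTree.Node 2 [:: GenTree.Leaf (b : nat); term_to_tree t]
  | CAnd d e => GenTree.Node 3 [:: code_to_tree d; code_to_tree e]
  | COr d e => GenTree.Node 4 [:: code_to_tree d; code_to_tree e]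
  | CAll t e => GenTree.Node 5 [:: term_to_tree t; code_to_tree e]
  | CEx e => GenTree.Node 6 [:: code_to_tree e]
  | CApp t e => GenTree.Node 7 [:: term_to_tree t; code_to_tree e]
  end.

Fixpoint tree_to_code (g : GenTree.tree nat) : code :=
  match g with
  | GenTree.Node 1 [:: g; h] => CLt (tree_to_term g) (tree_to_term h)
  | GenTree.Node 2 [:: GenTree.Leaf b; h] => COracle (b == 1) (tree_to_term h)
  | GenTree.Node 3 [:: g; h] => CAnd (tree_to_code g) (tree_to_code h)
  | GenTree.Node 4 [:: g; h] => COr (tree_to_code g) (tree_to_code h)
  | GenTree.Node 5 [:: g; h] => CAll (tree_to_term g) (tree_to_code h)
  | GenTree.Node 6 [:: g] => CEx (tree_to_code g)
  | GenTree.Node 7 [:: g; h] => CApp (tree_to_term g) (tree_to_code h)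
  | GenTree.Node _ [:: g; h] => CEq (tree_to_term g) (tree_to_term h)
  | _ => CEq Zero Zero
  end.

Lemma code_to_treeK : cancel code_to_tree tree_to_code.
Proof.
elim=> [t u|t u|[] t|d IHd e IHe|d IHd e IHe|t e IH|e IH|t e IH] /=;
  by rewrite ?term_to_treeK ?IHd ?IHe ?IH.
Qed.

Definition code_enum (n : nat) : code :=
  tree_to_code (odflt (GenTree.Leaf 0) (unpickle n)).

Lemma code_enum_surj e : exists n, code_enum n = e.
Proof.
by exists (pickle (code_to_tree e)); rewrite /code_enum pickleK /= code_to_treeK.
Qed.

(** * The omega-model of the sets recursive in a coloring *)

Definition sigma1 (c : nat -> bool) (R : (nat -> nat) -> Prop) : Prop :=
  exists e, forall rho, csat c e rho <-> R rho.

Definition delta1 (c : nat -> bool) (R : (nat -> nat) -> Prop) : Prop :=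
  sigma1 c R /\ sigma1 c (fun rho => ~ R rho).

Definition rec_in (c : nat -> bool) (X : nat -> Prop) : Prop :=
  delta1 c (fun rho => X (rho 0)).

Section RecursiveModel.

Variable c : nat -> bool.

Lemma sigma1_ext R R' :
  (forall rho, R rho <-> R' rho) -> sigma1 c R -> sigma1 c R'.
Proof. by move=> RR' [e he]; exists e => rho; rewrite he. Qed.

Lemma sigma1_and R R' :
  sigma1 c R -> sigma1 c R' -> sigma1 c (fun rho => R rho /\ R' rho).
Proof. by move=> [d hd] [e he]; exists (CAnd d e) => rho /=; rewrite hd he. Qed.

Lemma sigma1_or R R' :
  sigma1 c R -> sigma1 c R' -> sigma1 c (fun rho => R rho \/ R' rho).
Proof. by move=> [d hd] [e he]; exists (COr d e) => rho /=; rewrite hd he. Qed.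

Lemma sigma1_ex R :
  sigma1 c R -> sigma1 c (fun rho => exists x, R (scons x rho)).
Proof.
by move=> [e he]; exists (CEx e) => rho /=; split=> -[x]; exists x; apply/he.
Qed.

Lemma sigma1_all t R : sigma1 c R ->
  sigma1 c (fun rho => forall x, x < teval rho t -> R (scons x rho)).
Proof.
by move=> [e he]; exists (CAll t e) => rho /=; split=> h x xt; apply/he; apply: h.
Qed.

Lemma sigma1_app t R :
  sigma1 c R -> sigma1 c (fun rho => R (scons (teval rho t) rho)).
Proof. by move=> [e he]; exists (CApp t e) => rho /=; rewrite he. Qed.

Lemma sigma1_eq t u : sigma1 c (fun rho => teval rho t = teval rho u).
Proof. by exists (CEq t u). Qed.

Lemma sigma1_lt t u : sigma1 c (fun rho => teval rho t < teval rho u).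
Proof. by exists (CLt t u). Qed.

Lemma delta1_ext R R' :
  (forall rho, R rho <-> R' rho) -> delta1 c R -> delta1 c R'.
Proof.
move=> RR' [h h']; split; first exact: sigma1_ext h.
by apply: sigma1_ext h' => rho; rewrite RR'.
Qed.

Lemma delta1_not R : delta1 c R -> delta1 c (fun rho => ~ R rho).
Proof.
move=> [h h']; split=> //; apply: sigma1_ext h => rho.
by split=> [? //|]; exact: NNPP.
Qed.

Lemma delta1_and R R' :
  delta1 c R -> delta1 c R' -> delta1 c (fun rho => R rho /\ R' rho).
Proof.
move=> [h h'] [g g']; split; first exact: sigma1_and.
by apply: sigma1_ext (sigma1_or h' g') => rho; tauto.
Qed.

Lemma delta1_or R R' :
  delta1 c R -> delta1 c R' -> delta1 c (fun rho => R rho \/ R' rho).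
Proof.
move=> h g; apply: delta1_ext (delta1_not (delta1_and (delta1_not h) (delta1_not g))).
by move=> rho; tauto.
Qed.

Lemma delta1_imp R R' :
  delta1 c R -> delta1 c R' -> delta1 c (fun rho => R rho -> R' rho).
Proof.
move=> h g; apply: delta1_ext (delta1_or (delta1_not h) g).
by move=> rho; tauto.
Qed.

Lemma delta1_lt t u : delta1 c (fun rho => teval rho t < teval rho u).
Proof.
split; first exact: sigma1_lt.
apply: sigma1_ext (sigma1_or (sigma1_lt u t) (sigma1_eq u t)) => rho /=.
by split; lia.
Qed.

Lemma delta1_eq t u : delta1 c (fun rho => teval rho t = teval rho u).
Proof.
split; first exact: sigma1_eq.
apply: sigma1_ext (sigma1_or (sigma1_lt t u) (sigma1_lt u t)) => rho /=.
by split; lia.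
Qed.

Lemma delta1_oracle t : delta1 c (fun rho => c (teval rho t)).
Proof.
split; first by exists (COracle true t).
by exists (COracle false t) => rho /=; case: (c _); split.
Qed.

Lemma delta1_app t R :
  delta1 c R -> delta1 c (fun rho => R (scons (teval rho t) rho)).
Proof. by move=> [h h']; split; [exact: sigma1_app h|exact: sigma1_app h']. Qed.

Lemma delta1_all t R : delta1 c R ->
  delta1 c (fun rho => forall x, x < teval rho t -> R (scons x rho)).
Proof.
move=> [h h']; split; first exact: sigma1_all.
have := sigma1_ex (sigma1_and (sigma1_lt (Var 0) (tshift 1 t)) h').
apply: sigma1_ext => rho; split.
  by move=> [x []]; rewrite teval_shift1 => xt nR /(_ x xt).
move=> nall; apply: NNPP => nex; apply: nall => x xt; apply: NNPP => nR.
by apply: nex; exists x; rewrite teval_shift1.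
Qed.

Lemma delta1_ex t R : delta1 c R ->
  delta1 c (fun rho => exists x, x < teval rho t /\ R (scons x rho)).
Proof.
move=> h; apply: delta1_ext (delta1_not (delta1_all t (delta1_not h))) => rho.
split=> [nall|[x [xt Rx]] /(_ x xt)//].
apply: NNPP => nex; apply: nall => x xt Rx.
by apply: nex; exists x.
Qed.

(** The substitution [s] carries the induction under bounded quantifiers and later puts numerals for
    the number parameters of a comprehension instance. *)
Lemma delta1_Delta00 S p : Delta00 p ->
  forall (s : nat -> term) sigma, (forall i, rec_in c (sigma i)) ->
  delta1 c (fun rho => sat S p (fun i => teval rho (s i)) sigma).
Proof.
elim=> {p} [t u|t u|t X||p q _ IHp _ IHq|p q _ IHp _ IHq|p q _ IHp _ IHq|t p _ IH|t p _ IH]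
  s sigma Rsig.
- apply: delta1_ext (delta1_eq (tsubst s t) (tsubst s u)) => rho.
  by rewrite !teval_subst.
- apply: delta1_ext (delta1_lt (tsubst s t) (tsubst s u)) => rho.
  by rewrite !teval_subst.
- apply: delta1_ext (delta1_app (tsubst s t) (Rsig X)) => rho /=.
  by rewrite teval_subst.
- apply: delta1_ext (delta1_lt Zero Zero) => rho /=; by split.
- by apply: delta1_imp; [exact: IHp|exact: IHq].
- by apply: delta1_and; [exact: IHp|exact: IHq].
- by apply: delta1_or; [exact: IHp|exact: IHq].
- apply: delta1_ext (delta1_all (tsubst s t) (IH (upN s) sigma Rsig)) => rho /=.
  by split=> h x; move: (h x); rewrite teval_upN teval_shift1 teval_subst.
- apply: delta1_ext (delta1_ex (tsubst s t) (IH (upN s) sigma Rsig)) => rho /=.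
  by split=> -[x]; rewrite ?teval_upN ?teval_shift1 teval_subst => h;
    exists x; rewrite ?teval_upN ?teval_shift1 ?teval_subst.
Qed.

(** Induction is inherited from the standard naturals. In comprehension, the [Sigma01] formula
    yields a code for the set and the [Pi01] formula one for its complement. *)
Lemma sat_RCA0 p : RCA0 p -> forall rho sigma,
  (forall i, rec_in c (sigma i)) -> sat (rec_in c) p rho sigma.
Proof.
case=> {p} [p ax|p _|_ _ [p Dp] [q Dq]] rho sigma.
- by move=> _; repeat (destruct ax as [<-|ax]; [move=> /=; lia|]).
- move=> _ /= [p0 pS]; elim=> [|x IHx]; first by move: p0; rewrite sat_instN.
  move: (pS x IHx); rewrite sat_subst (scons_comp (teval (scons x rho))) /=.
  by rewrite addn1.
move=> Rsig /= pq.
exists (fun n => exists x, sat (rec_in c) p (scons x (scons n rho)) sigma); last first.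
  by move=> x; exact: iff_sym (sat_shiftS (rec_in c) (ExN p) _ _ _).
(* Variable 0 is the witness and 1 the candidate element; the parameters in [rho] become numerals,
   so only the element is left as input. *)
pose s := scons (Var 0) (scons (Var 1) (fun i => numeral (rho i))).
have sE x rho' : (fun i => teval (scons x rho') (s i)) =
    scons x (scons (rho' 0) rho).
  by apply: functional_extensionality => -[|[|i]] //=; rewrite teval_numeral.
split.
  apply: sigma1_ext (sigma1_ex (delta1_Delta00 (rec_in c) Dp s Rsig).1) => rho'.
  by split=> -[x]; exists x; rewrite ?sE // -sE.
apply: sigma1_ext (sigma1_ex (delta1_Delta00 (rec_in c) Dq s Rsig).2) => rho'.
split=> [[x]|].
  by rewrite sE => nq; case: (pq (rho' 0)) => /= pq' _ /pq' /(_ x).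
move=> np; apply: NNPP => nq; apply: np; case: (pq (rho' 0)) => /= _; apply=> x.
by apply: NNPP => nqx; apply: nq; exists x; rewrite sE.
Qed.

Lemma rec_in_graph :
  rec_in c (fun m => exists n, 0 < n /\ m = (n + c n) * (n + c n) + n).
Proof.
pose sq b : term := ((#0 + numeral b) * (#0 + numeral b) + #0)%T.
(* The search for [n] is bounded by the code of the pair, since [n <= (n + b) * (n + b) + n]. *)
pose D := delta1_ex (#0 + 1)%T (delta1_and (delta1_lt Zero (Var 0))
  (delta1_or (delta1_and (delta1_oracle (Var 0)) (delta1_eq (Var 1) (sq 1)))
   (delta1_and (delta1_not (delta1_oracle (Var 0))) (delta1_eq (Var 1) (sq 0))))).
apply: delta1_ext D => rho /=; split=> [[n [nm [n0 h]]]|[n [n0 E]]]; exists n.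
  by split=> //; case: h => -[]; case: (c n).
split; first by lia.
by split=> //; move: E; case: (c n) => ->; [left|right].
Qed.

End RecursiveModel.

(** * The combinatorial consequence of HT in the model *)

Definition unbounded (X : nat -> Prop) : Prop := forall m, exists2 x, m < x & X x.

Definition sum_homogeneous (c : nat -> bool) (X : nat -> Prop) : Prop :=
  forall x y, X x -> X y -> x <> y -> c (x + y) = c x.

(** With [s = m + b], the code is at least [s * s] and below [(s + 1) * (s + 1)], so it determines
    [s]. *)
Lemma pair_inj m n b d :
  (m + b) * (m + b) + m = (n + d) * (n + d) + n -> m = n /\ b = d.
Proof.
move=> E; suff F : m + b = n + d by rewrite F in E; lia.
by nia.
Qed.

Lemma sat_HT c : sat (rec_in c) (HT 2 2) (fun=> 0) (fun _ _ => True) ->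
  exists X, [/\ rec_in c X, forall x, X x -> 0 < x, unbounded X & sum_homogeneous c X].
Proof.
move=> h; case: (h _ (rec_in_graph c)) => {h} [|X RX [/= pos [inf mono]]].
  split=> /= [m [n [n0 ->]]|n n0].
    by exists n, (c n : nat); split=> //; split=> //; case: (c n).
  exists (c n : nat); split; first by split; [case: (c n)|exists n].
  move=> b [b2 [n' [n'0 E]]].
  by have [-> ->] := pair_inj E.
exists X; split=> //.
  by move=> m; case: (inf m) => x [mx Xx]; exists x.
(* Compare the two-element sum [x + y] with the one-element sum [x]. *)
move=> x y Xx Xy xy; have [|b []] := mono (x + y) x.
  split.
    right; left; exists y, x => /=; split; first by [].
    by split; [|rewrite addn0 addnC]; split => // E; apply: xy.
  by left; exists x => /=; rewrite addn0.
move=> [n [_ /pair_inj[<- bc]]] [n' [_ /pair_inj[<- bc']]].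
by move: bc'; rewrite bc; case: (c (x + y)); case: (c x).
Qed.

(** * Ternary valuation, last nonzero ternary digit, and their behavior under addition *)

Definition digit (n : nat) : nat := (n %/ 3 ^ logn 3 n) %% 3.

Lemma ternary_split n : 0 < n ->
  exists2 m, n = 3 ^ logn 3 n * m & digit n = m %% 3 /\ m %% 3 != 0.
Proof.
move=> n0; have [//|m co E] := @pfactor_coprime 3 n _ n0.
exists m; first by rewrite mulnC.
rewrite /digit {1}E mulnK ?expn_gt0 //; split=> //.
by rewrite -/(dvdn 3 m) -prime_coprime.
Qed.

Lemma ternary_mul k m : m %% 3 != 0 ->
  logn 3 (3 ^ k * m) = k /\ digit (3 ^ k * m) = m %% 3.
Proof.
move=> m3; have m0 : 0 < m by case: m m3.
have L : logn 3 (3 ^ k * m) = k.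
  rewrite lognM ?expn_gt0 // pfactorK // lognE /=.
  by rewrite m0 /dvdn (negbTE m3) addn0.
by rewrite /digit L mulKn ?expn_gt0.
Qed.

(** Doubling swaps the residues 1 and 2 modulo 3, so the cofactors add up to another non-multiple of
    3. *)
Lemma ternary_add_same x y : 0 < x -> 0 < y ->
  logn 3 x = logn 3 y -> digit x = digit y ->
  logn 3 (x + y) = logn 3 x /\ (digit (x + y) == 1) = ~~ (digit x == 1).
Proof.
move=> x0 y0 L D.
have [m Ex [Dx mx]] := ternary_split x0; have [n Ey [Dy ny]] := ternary_split y0.
have mn3 : (m + n) %% 3 != 0 by lia.
have E : x + y = 3 ^ logn 3 x * (m + n) by rewrite mulnDr -Ex L -Ey.
have [L' D'] := ternary_mul (logn 3 x) mn3.
by rewrite E L' D' Dx; split=> //; lia.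
Qed.

(** Adding [y] changes the cofactor of [x] by a multiple of 3. *)
Lemma ternary_add_lt x y : 0 < x -> 0 < y -> logn 3 x < logn 3 y ->
  logn 3 (x + y) = logn 3 x /\ digit (x + y) = digit x.
Proof.
move=> x0 y0 L.
have [m Ex [Dx mx]] := ternary_split x0.
have /dvdnP[q Ey] : 3 ^ (logn 3 x).+1 %| y by rewrite pfactor_dvdn.
have mn3 : (m + q * 3) %% 3 != 0 by lia.
have E : x + y = 3 ^ logn 3 x * (m + q * 3).
  by rewrite mulnDr -Ex Ey expnS; lia.
have [L' D'] := ternary_mul (logn 3 x) mn3.
by rewrite E L' D' Dx; split=> //; lia.
Qed.

(** Either the top value is taken twice, or it is avoided from some point on and the tail of [X] has
    one value fewer to use. *)
Lemma unbounded_pigeonhole (f : nat -> nat) M : forall X,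
  unbounded X -> (forall x, X x -> f x < M) ->
  exists x y, [/\ X x, X y, x < y & f x = f y].
Proof.
elim: M => [|M IH] X inf fM; first by have [x _ /fM] := inf 0.
have [[x0 [Xx0 fx0]]|none] := classic (exists x, X x /\ f x = M); last first.
  apply: IH => // x Xx; have := fM x Xx; rewrite ltnS leq_eqVlt => /orP[/eqP E|//].
  by case: none; exists x.
have [[y [Xy xy fy]]|none] := classic (exists y, [/\ X y, x0 < y & f y = M]).
  by exists x0, y; rewrite fx0 fy.
case: (IH (fun x => X x /\ x0 < x)) => [m|x [Xx xx0]|x [y [[Xx _] [Xy _] xy E]]].
- by have [x mx Xx] := inf (maxn m x0); exists x; [|split=> //]; lia.
- have := fM x Xx; rewrite ltnS leq_eqVlt => /orP[/eqP E|//].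
  by case: none; exists x.
- by exists x, y.
Qed.

(** * Forcing conditions and their refinement *)

(** The color that [lim] assigns to [n]; it changes when two numbers with the
    same ternary valuation and leading digit are added. *)
Definition target (lim : nat -> bool) (n : nat) : bool :=
  lim (logn 3 n) (+) (digit n == 1).

(** The colors of the numbers below [cond_size] are those of [cond_base]; later
    numbers of ternary valuation below [cond_locks] get their target color. *)
Record condition := Condition {
  cond_base : nat -> bool;
  cond_lim : nat -> bool;
  cond_size : nat;
  cond_locks : nat
}.

Definition meets (p : condition) (c : nat -> bool) : Prop :=
  agree (cond_size p) (cond_base p) c /\
  forall n, 0 < n -> cond_size p <= n -> logn 3 n < cond_locks p ->
    c n = target (cond_lim p) n.

Definition refines (q p : condition) : Prop := forall c, meets q c -> meets p c.

(** A witness that every condition can be met; it takes target colors at unlocked valuations as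
    well. *)
Definition generic_element (p : condition) (n : nat) : bool :=
  if n < cond_size p then cond_base p n else target (cond_lim p) n.

Lemma meets_generic_element p : meets p (generic_element p).
Proof.
split=> n; first by rewrite /generic_element => ->.
by rewrite /generic_element [n < _]ltnNge => _ ->.
Qed.

(** The new base meets [p], so the colors fixed between the two sizes respect the old locks. *)
Lemma refines_intro p c lim N K : meets p c ->
  cond_size p <= N -> cond_locks p <= K ->
  (forall k, k < cond_locks p -> lim k = cond_lim p k) ->
  refines (Condition c lim N K) p.
Proof.
move=> [cb ct] pN pK limE c' [/= c'b c't]; split=> n.
  by move=> np; rewrite c'b ?cb //; lia.
move=> n0 pn npK; have [nN|Nn] := ltnP n N; first by rewrite c'b ?ct.
by rewrite c't //; [rewrite /target limE|lia].
Qed.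

Lemma locked_not_homogeneous p c X : meets p c ->
  (forall x, X x -> 0 < x) -> unbounded X ->
  (forall x, X x -> cond_size p <= x -> logn 3 x < cond_locks p) ->
  ~ sum_homogeneous c X.
Proof.
move=> [_ ct] pos inf lock hom.
(* Valuation and residue packed into one number below [cond_locks p * 2], so that two late elements
   share both. *)
pose f x := (logn 3 x) * 2 + (digit x == 1).
case: (@unbounded_pigeonhole f ((cond_locks p) * 2) (fun x => X x /\ cond_size p <= x)).
- by move=> m; have [x] := inf (maxn m (cond_size p)); exists x; [|split=> //]; lia.
- by move=> x [Xx px]; have := lock x Xx px; rewrite /f; case: (_ == 1); lia.
move=> x [y [[Xx px] [Xy py] xy fE]].
have x0 := pos x Xx; have y0 := pos y Xy.
have [L D1] : logn 3 x = logn 3 y /\ (digit x == 1) = (digit y == 1).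
  by move: fE; rewrite /f; case: (digit x == 1); case: (digit y == 1); lia.
have D : digit x = digit y.
  have [m _ [Dx mx]] := ternary_split x0; have [n _ [Dy ny]] := ternary_split y0.
  by move: D1; rewrite Dx Dy; lia.
have [L' D'] := ternary_add_same x0 y0 L D.
have nxy : x <> y by lia.
have := hom x y Xx Xy nxy; rewrite !ct ?L' ?lock //; try lia.
by rewrite /target L' D'; case: (cond_lim p _); case: (digit x == 1).
Qed.

Definition defeated (e : code) (c : nat -> bool) : Prop :=
  forall X, (forall rho, csat c e rho <-> X (rho 0)) ->
  (forall x, X x -> 0 < x) -> unbounded X -> ~ sum_homogeneous c X.

Lemma defeat p e : exists2 q, refines q p & forall c, meets q c -> defeated e c.
Proof.
pose elem c x := csat c e (fun=> x).
(* Can some coloring meeting [p] put an element of unlocked valuation into the set coded by [e]? If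
   not, [p] itself already defeats [e]. *)
have [[c [x [pc ex x0 lx]]]|none] := classic (exists c x,
    [/\ meets p c, elem c x, 0 < x & cond_locks p <= logn 3 x]); last first.
  exists p => // c pc X eX pos inf; apply: (locked_not_homogeneous pc) => // x Xx _.
  rewrite ltnNge; apply/negP => lx; apply: none; exists c, x; split=> //.
    exact/eX.
  exact: pos.
have [N hN] := csat_use ex.
(* Locking the valuation of [x] with the color opposite to [c x] makes
   [x + y] differ from [x] for every late [y] of larger valuation. *)
pose lim k := if k < cond_locks p then cond_lim p k
              else ~~ c x (+) (digit x == 1).
(* The size exceeds the use [N] and [x], which keeps [x] in the set and fixes its color; the locks
   now include the valuation of [x]. *)
pose q := Condition c lim (maxn (cond_size p) (maxn N x.+1)) (logn 3 x).+1.
exists q.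
  apply: refines_intro => //; [lia|lia|].
  by move=> k kp; rewrite /lim kp.
move=> c' qc' X eX pos inf hom.
(* If no late element has valuation above that of [x], all late elements are locked. So suppose [y]
   is such an element and refute it through [x + y]. *)
apply: (locked_not_homogeneous qc' pos inf _ hom) => y Xy /= qy.
rewrite ltnS leqNgt; apply/negP => lxy.
have Xx : X x.
  by apply/(eX (fun=> x)); apply: hN => n nN; apply: qc'.1 => /=; lia.
have [L D] := ternary_add_lt x0 (pos y Xy) lxy.
have nxy : x <> y by move=> E; move: lxy; rewrite E; lia.
have := hom x y Xx Xy nxy; rewrite (qc'.2 (x + y)) /= ?L //; [|lia|lia].
rewrite (qc'.1 x) /=; last by lia.
by rewrite /target L D /lim ltnNge lx /=; case: (c x); case: (digit x == 1).
Qed.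

(** Growing the size at each step makes a chain of conditions decide every color. *)
Lemma defeat_and_grow p n : exists q, [/\ refines q p, n <= cond_size q &
  forall c, meets q c -> defeated (code_enum n) c].
Proof.
have [q qp hq] := defeat p (code_enum n).
pose r := Condition (generic_element q) (cond_lim q) (maxn n (cond_size q)) (cond_locks q).
have rq : refines r q.
  by apply: refines_intro => //; [exact: meets_generic_element|lia].
by exists r; split=> [c /rq/qp//||c /rq/hq//] /=; lia.
Qed.

(** * The generic coloring and unprovability *)

Lemma generic_coloring : exists c, forall e, defeated e c.
Proof.
pose next n p := proj1_sig (constructive_indefinite_description _ (defeat_and_grow p n)).
have nextP n p : [/\ refines (next n p) p, n <= cond_size (next n p) &
    forall c, meets (next n p) c -> defeated (code_enum n) c].
  by rewrite /next; case: constructive_indefinite_description.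
pose fix chain n := if n is m.+1 then next m (chain m)
  else Condition xpred0 xpred0 0 0.
have chainR m n : m <= n -> refines (chain n) (chain m).
  elim: n => [|n IH]; first by rewrite leqn0 => /eqP->.
  rewrite leq_eqVlt => /orP[/eqP-> //|/IH nm c h].
  by apply: nm; have [h' _ _] := nextP n (chain n); apply: h'.
have chainN n : n <= cond_size (chain n.+1) by have [] := nextP n (chain n).
(* [chainN n.+1] gives [n < cond_size (chain n.+2)], so the color of [n] is settled there. *)
pose c n := cond_base (chain n.+2) n.
have cE n d : meets (chain n.+2) d -> d n = c n.
  by move=> [+ _]; apply; exact: chainN.
have meets_c n : meets (chain n) c.
  (* Meeting a condition is tested one number at a time: at [m], [c] agrees with [g m], which meets
     a condition late enough both to decide [m] and to refine [chain n]. *)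
  pose g m := generic_element (chain (maxn n m.+2)).
  have gn m : meets (chain n) (g m).
    by apply: (chainR n (maxn n m.+2)); [lia|exact: meets_generic_element].
  have gc m : g m m = c m.
    by apply: cE; apply: (chainR m.+2 (maxn n m.+2)); [lia|exact: meets_generic_element].
  by split=> m; rewrite -gc => *; [apply: (gn m).1|apply: (gn m).2].
exists c => e; have [n <-] := code_enum_surj e.
by have [_ _ h] := nextP n (chain n); apply: h; exact: (meets_c n.+1).
Qed.

Theorem corollary2p3 : ~ provable RCA0 (HT 2 2).
Proof.
move=> HTp; have [c hc] := generic_coloring.
(* Soundness requires the set environment, here constantly the full set, to lie in the model. *)
have Rfull : rec_in c (fun=> True).
  by apply: delta1_ext (delta1_eq c Zero Zero) => rho.
have [] := @sat_HT c.
  by apply: (soundness (@sat_RCA0 c) HTp) => // h [].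
by move=> X [[[e eX] _] pos inf hom]; exact: (hc e X).
Qed.
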